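(* (1) For every $\Gamma\in\{\mathbf{\Sigma}^0_\alpha,\mathbf{\Pi}^0_\alpha,\mathbf{\Sigma}^1_n,\mathbf{\Pi}^1_n\mid \omega\le\alpha<\omega_1,\ 1\le n<\omega\}$ we have $\mathrm{QCB}_0(\Gamma)\cap\mathrm{CB}_0=\mathrm{CB}_0(\Gamma)$. (2) For all natural numbers $m\ge2$ and $n\ge3$ we have $\mathrm{QCB}_0(\mathbf{\Pi}^0_m)\cap\mathrm{CB}_0=\mathrm{CB}_0(\mathbf{\Pi}^0_m)$ and $\mathrm{QCB}_0(\mathbf{\Sigma}^0_n)\cap\mathrm{CB}_0=\mathrm{CB}_0(\mathbf{\Sigma}^0_n)$.
   Context: $\mathrm{CB}_0$ denotes the class of countably based $T_0$-spaces. Let $\mathcal{N}=\omega^\omega$ be the Baire space. For an arbitrary topological space $X$: $\mathbf{\Sigma}^0_0(X)=\{\emptyset\}$; $\mathbf{\Sigma}^0_1(X)$ is the family of open sets; $\mathbf{\Sigma}^0_2(X)$ is the family of countable unions of sets $U\setminus V$ with $U,V$ open; for $2<\alpha<\omega_1$, $\mathbf{\Sigma}^0_\alpha(X)$ is the family of countable unions of sets whose complements lie in $\bigcup_{\beta<\alpha}\mathbf{\Sigma}^0_\beta(X)$; $\mathbf{\Pi}^0_\alpha(X)$ = complements of $\mathbf{\Sigma}^0_\alpha(X)$-sets. $\mathbf{\Sigma}^1_1(X)=\{pr_X(A)\mid A\in\mathbf{\Pi}^0_2(\mathcal{N}\times X)\}$, $\mathbf{\Sigma}^1_{n+1}(X)=\{pr_X(A)\mid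 A\in\mathbf{\Pi}^1_n(\mathcal{N}\times X)\}$, with $pr_X(A)=\{x\mid\exists p\in\mathcal{N}\,(p,x)\in A\}$; $\mathbf{\Pi}^1_n(X)$ = complements of $\mathbf{\Sigma}^1_n(X)$-sets. $P\omega$ is the power set of $\omega$ with the Scott topology (basic open sets $\{A\subseteq\omega\mid F\subseteq A\}$, $F$ finite). $\mathrm{CB}_0(\Gamma)$ is the class of spaces homeomorphic to a subspace $A\subseteq P\omega$ with $A\in\Gamma(P\omega)$. A representation of $X$ is a surjection $\delta$ from $\mathrm{dom}(\delta)\subseteq\mathcal{N}$ onto $X$; it is admissible if continuous and every continuous $\nu:Z\to X$ from a zero-dimensional countably based $T_0$-space $Z$ factors as $\nu=\delta g$ with $g:Z\to\mathrm{dom}(\delta)$ continuous. $\mathit{EQ}(\delta)=\{(p,q)\mid p,q\in\mathrm{dom}(\delta),\delta(p)=\delta(q)\}$. $\mathrm{QCB}_0(\Gamma)$ is the class of spaces having an admissible representation $\delta$ with $\mathit{EQ}(\delta)\in\Gamma(\mathcal{N}\times\mathcal{N})$. *)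

(* Defs.v *)
From HB Require Import structures.
From mathcomp Require Import all_boot all_order.
From mathcomp Require Import all_classical topology.
Set Implicit Arguments.
Unset Strict Implicit.
Unset Printing Implicit Defensive.

Import Order.TTheory.
Local Open Scope classical_set_scope.
Local Open Scope card_scope.

Definition baire_space : Type := prod_topology (fun _ : nat => nat).

HB.instance Definition _ := Pointed.on baire_space.
HB.instance Definition _ := Topological.on baire_space.

Definition Pomega : Type := set nat.

HB.instance Definition _ := Pointed.on Pomega.

Definition Pomega_up (F : set nat) : set Pomega := [set A : set nat | F `<=` A].

Lemma Pomega_up_cover :
  \bigcup_(F in [set F | finite_set F]) Pomega_up F = setT.
Proof.
apply/seteqP; split=> // A _.
by exists set0; [exact: finite_set0 | exact: sub0set].
Qed.

Lemma Pomega_up_join (F G : set nat) (A : Pomega) :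
  finite_set F -> finite_set G -> Pomega_up F A -> Pomega_up G A ->
  exists H, [/\ finite_set H, Pomega_up H A &
    Pomega_up H `<=` Pomega_up F `&` Pomega_up G].
Proof.
move=> finF finG FA GA; exists (F `|` G); split.
- by rewrite finite_setU.
- by rewrite /Pomega_up /= subUset.
- by move=> B; rewrite /Pomega_up /= subUset.
Qed.

HB.instance Definition _ := isBaseTopological.Build Pomega
  Pomega_up_cover Pomega_up_join.

Definition pointclass := forall X : topologicalType, set (set X).

Definition dual (Gamma : pointclass) : pointclass :=
  fun X => [set A | Gamma X (~` A)].
Arguments dual Gamma X _ : clear implicits.

Definition below {d} {W : orderType d} (a : W) : set W := [set b | (b < a)%O].

(* A countable ordinal is given as an element a of a countable well-ordered
   type W: a stands for the order type of below a, so that m : nat stands for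
   the finite ordinal m. Well-foundedness and countability of W are hypotheses
   where W is not nat.
   Countable unions are indexed by all of nat, which covers finite and empty
   ones: repeat a term, or use empty terms. *)
Inductive Sigma0 {d} {W : orderType d} (a : W) (X : topologicalType) :
    set X -> Prop :=
| Sigma0_0 : below a #= `I_0 -> Sigma0 a set0
| Sigma0_1 (U : set X) : below a #= `I_1 -> open U -> Sigma0 a U
| Sigma0_2 (U V : nat -> set X) : below a #= `I_2 ->
    (forall i, open (U i)) -> (forall i, open (V i)) ->
    Sigma0 a (\bigcup_i (U i `\` V i))
| Sigma0_gt2 (b : nat -> W) (A : nat -> set X) : `I_3 #<= below a ->
    (forall i, (b i < a)%O) -> (forall i, Sigma0 (b i) (~` A i)) ->
    Sigma0 a (\bigcup_i A i).
Arguments Sigma0 {d W} a X _.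

Definition Pi0 {d} {W : orderType d} (a : W) : pointclass := dual (Sigma0 a).
Arguments Pi0 {d W} a X _.

Definition pr (X : topologicalType) (A : set (baire_space * X)) : set X :=
  [set x | exists p, A (p, x)].

(* Level 0 is not part of the projective hierarchy: it is set to Sigma^0_2 so
   that Sigma^1_1 = pr Pi^0_2 is an instance of the recursion. *)
Fixpoint Sigma1 (n : nat) : pointclass :=
  match n with
  | 0 => Sigma0 2%N
  | n'.+1 => fun X => @pr X @` dual (Sigma1 n') (baire_space * X)%type
  end.
Arguments Sigma1 n X _ : clear implicits.

Definition Pi1 (n : nat) : pointclass := dual (Sigma1 n).
Arguments Pi1 n X _ : clear implicits.

Definition CB0 (X : topologicalType) : Prop :=
  @second_countable X /\ kolmogorov_space X.

Definition homeomorphic (X Y : topologicalType) : Prop :=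
  exists (f : X -> Y) (g : Y -> X),
    [/\ continuous f, continuous g, cancel f g & cancel g f].

Definition CB0_in (Gamma : pointclass) (X : topologicalType) : Prop :=
  exists2 A : set Pomega, Gamma Pomega A & homeomorphic X A.

(* [zero_dimensional] of the library only asks that clopen sets separate
   points, which is weaker than having a base of clopen sets. *)
Definition clopen_based (Z : topologicalType) : Prop := basis (@clopen Z).

Definition representation (X : topologicalType) (D : set baire_space)
    (delta : D -> X) : Prop :=
  forall x, exists p, delta p = x.

Definition admissible (X : topologicalType) (D : set baire_space)
    (delta : D -> X) : Prop :=
  [/\ representation delta, continuous delta &
      forall (Z : topologicalType) (nu : Z -> X),
        CB0 Z -> clopen_based Z -> continuous nu ->
        exists2 g : Z -> D, continuous g & nu = delta \o g].

Definition EQ (X : topologicalType) (D : set baire_space) (delta : D -> X) :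
    set (baire_space * baire_space) :=
  [set pq | exists p q : D,
     pq = (set_val p, set_val q) /\ delta p = delta q].

Definition QCB0 (Gamma : pointclass) (X : topologicalType) : Prop :=
  exists (D : set baire_space) (delta : D -> X),
    admissible delta /\ Gamma (baire_space * baire_space)%type (EQ delta).

(* Main.v *)
Require Import Defs.
From mathcomp Require Import all_boot all_order.
From mathcomp Require Import all_classical topology.
Set Implicit Arguments.
Unset Strict Implicit.
Unset Printing Implicit Defensive.
Import Order.TTheory.
Local Open Scope classical_set_scope.
Local Open Scope card_scope.

(** The enumeration map rho p = {k | k + 1 in the range of p} is a continuous
    surjection of the Baire space onto Pomega whose restriction to the preimage
    of a subspace A is an admissible representation of A, so its EQ relation is
    the preimage of A cut down by the Pi^0_2 relation rho p = rho q.
    Conversely, if delta is any admissible representation of A, the restriction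
    of rho factors as delta o g; extending delta to a total map into Pomega and g
    to a Pi^0_2 set Q describes the preimage of A as the set of the p in Q such
    that g p is in the domain of delta and delta (g p) = rho p.  It remains to see
    that A is in Gamma when its preimage under rho is.  For the projective classes
    A is a projection of {(p, x) | rho p = x, p in the preimage}.  For the Borel
    classes this is a forcing version of the Vaught transform: points of the fibre
    of x that are generic for suitable countably many dense sets decide the
    preimage of A through finite prefixes s, and the set of the x for which s
    forces a Sigma^0_alpha set is again Sigma^0_alpha. *)

(** * The topologies of Pomega and of the Baire space *)

Lemma Pomega_openP (U : set Pomega) :
  open U <-> forall A, U A ->
    exists F, [/\ finite_set F, F `<=` A & Pomega_up F `<=` U].
Proof.
split=> [[D sD <-] A [F DF FA]|UP].
  by exists F; split=> //; [exact: sD|move=> B FB; exists F].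
exists [set F | finite_set F /\ Pomega_up F `<=` U]; first by move=> F [].
apply/seteqP; split=> [A [F [_ FU] /FU]//|A /UP[F [finF FA FU]]].
by exists F.
Qed.

Lemma open_Pomega_mem k : open [set x : Pomega | x k].
Proof.
apply/Pomega_openP => A Ak; exists [set k]; split=> //.
  by move=> _ ->.
by move=> B /(_ k erefl).
Qed.

(** The sets of all [x] containing a given [k] form a subbase of [Pomega]. A basic open set is a
    finite intersection of them, treated by induction on a list of the finite set. *)
Lemma continuous_PomegaP (X : topologicalType) (f : X -> Pomega) :
  continuous f <-> forall k, open [set x | f x k].
Proof.
split=> [/continuousP cf k|fo]; first exact: cf (open_Pomega_mem k).
apply/continuousP => U /Pomega_openP UP; rewrite openE => x /UP[F [finF Fx FU]].
have /finite_seqP[s Fs] := finF.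
suff : nbhs x [set y | forall k, k \in s -> f y k].
  by apply: filterS => y ys; apply: FU; rewrite Fs => k /ys.
have : forall k, k \in s -> f x k by move=> k ks; apply: Fx; rewrite Fs.
elim: s {F finF Fx FU Fs} => [|k s IH] xs; first exact: filterE.
have /IH : forall k', k' \in s -> f x k'.
  by move=> k' k's; apply: xs; rewrite inE k's orbT.
have xk := open_nbhs_nbhs (conj (fo k) (xs k (mem_head k s))).
apply: filterS2 xk => y yk ys k'.
by rewrite inE => /orP[/eqP->//|/ys].
Qed.

Lemma continuous_baireP (X : topologicalType) (f : X -> baire_space) :
  continuous f <-> forall n m, open [set x | f x n = m].
Proof.
split=> [cf n m|fo].
  have cfn : continuous (fun x => f x n).
    move=> x; apply: (@continuous_comp _ _ _ f (fun q : baire_space => q n)).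
      exact: cf.
    exact: (@proj_continuous nat (fun=> nat) n).
  have := (@continuousP X nat _).1 cfn [set m]; apply.
  exact: (@discrete_open nat).
move=> x; apply/cvg_sup => n U [_ [[V oV <-] /= Vx VU]].
apply: filterS VU _; rewrite /= nbhs_simpl.
have : nbhs x [set y | f y n = f x n] by apply: open_nbhs_nbhs; split.
by apply: filterS => y /= ->.
Qed.

Lemma open_baire_coord n m : open [set p : baire_space | p n = m].
Proof. by move: n m; apply/continuous_baireP => p. Qed.

Definition cylinder (s : seq nat) : set baire_space :=
  [set p | mkseq p (size s) = s].

Lemma cylinder_mkseqE (p : baire_space) n :
  cylinder (mkseq p n) = [set q | mkseq q n = mkseq p n].
Proof. by rewrite /cylinder size_mkseq. Qed.

Lemma cylinder_mkseq (p : baire_space) n : cylinder (mkseq p n) p.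
Proof. by rewrite /cylinder /= size_mkseq. Qed.

Lemma open_cylinder s : open (cylinder s).
Proof.
elim/last_ind: s => [|s m IH].
  suff -> : cylinder [::] = setT by exact: openT.
  exact/seteqP.
have -> : cylinder (rcons s m) = cylinder s `&` [set p | p (size s) = m].
  apply/seteqP; split=> p; rewrite /cylinder /= size_rcons mkseqS.
    by move=> /rcons_inj[-> <-].
  by move=> -[-> ->].
exact: openI IH (open_baire_coord _ _).
Qed.

Lemma baire_nbhsP (p : baire_space) (U : set baire_space) :
  nbhs p U -> exists n, cylinder (mkseq p n) `<=` U.
Proof.
pose F := filter_from [set: nat] (fun n => cylinder (mkseq p n)).
have cylS n m : n <= m -> cylinder (mkseq p m) `<=` cylinder (mkseq p n).
  rewrite !cylinder_mkseqE => nm q /(congr1 (take n)) /=.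
  by rewrite /mkseq -!map_take !take_iota (minn_idPl nm).
have FF : Filter F.
  apply: filter_from_filter; first by exists 0.
  move=> i j _ _; exists (maxn i j) => // q qc; split; apply: cylS qc.
    exact: leq_maxl.
  exact: leq_maxr.
(* The product topology is the supremum of the coordinate topologies, so it suffices to treat one
   coordinate [n]; a prefix of length [n.+1] fixes it. *)
have Fp : F --> (p : baire_space).
  apply/cvg_sup => n V [_ [[O oO <-] /= Op OV]].
  exists n.+1 => // q; rewrite cylinder_mkseqE => /(congr1 (nth 0 ^~ n)).
  by rewrite !nth_mkseq// => qp; apply: OV; rewrite /= qp.
by move=> /Fp[n _]; exists n.
Qed.

(** * Borel classes *)

(** This is level 2 stated without a rank, so that it can be used next to any well-order. *)
Definition sigma2 (X : topologicalType) (S : set X) : Prop :=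
  exists U V : nat -> set X, [/\ forall i, open (U i), forall i, open (V i) &
    S = \bigcup_i (U i `\` V i)].

Definition pi2 (X : topologicalType) (S : set X) : Prop := sigma2 (~` S).

(** [Y] carries the initial topology along [f]; the injective maps of this kind are the embeddings.
    The notion treats subspace inclusions and their products with an identity map alike. *)
Definition inducing (X Y : topologicalType) (f : Y -> X) : Prop :=
  forall U, open U <-> exists2 V, open V & U = f @^-1` V.

Lemma inducing_continuous (X Y : topologicalType) (f : Y -> X) :
  inducing f -> continuous f.
Proof. by move=> If; apply/continuousP => V oV; apply/If; exists V. Qed.

Lemma inducing_set_val (X : topologicalType) (A : set X) :
  inducing (set_val : A -> X).
Proof. by move=> U; split=> -[V oV VU]; exists V. Qed.

Definition countable_cover (T : countType) X (P : set T) (S : T -> set X) n :=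
  if unpickle n is Some t then if `[< P t >] then S t else set0 else set0.

Lemma bigcup_countable_cover (T : countType) X (P : set T) (S : T -> set X) :
  \bigcup_(t in P) S t = \bigcup_n countable_cover P S n.
Proof.
apply/seteqP; split=> [x [t Pt St]|x [n _]].
  by exists (pickle t) => //; rewrite /countable_cover pickleK (asboolT Pt).
rewrite /countable_cover; case: unpickle => // t.
by case: ifPn => // /asboolP Pt St; exists t.
Qed.

Section sigma2_theory.
Context {X : topologicalType}.
Implicit Types S T U V : set X.

Lemma sigma2_diff U V : open U -> open V -> sigma2 (U `\` V).
Proof.
by move=> oU oV; exists (fun=> U), (fun=> V); split=> //; rewrite bigcup_const.
Qed.

Lemma sigma2_open U : open U -> sigma2 U.
Proof. by move=> oU; rewrite -[U]setD0; apply: sigma2_diff oU open0. Qed.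

Lemma sigma2_closed U : open U -> sigma2 (~` U).
Proof. by move=> oU; rewrite -setTD; apply: sigma2_diff openT oU. Qed.

Lemma sigma2_bigcup (S : nat -> set X) :
  (forall i, sigma2 (S i)) -> sigma2 (\bigcup_i S i).
Proof.
move=> /choice[U] /choice[V] UV.
pose k n : nat * nat := odflt (0, 0) (unpickle n).
exists (fun n => U (k n).1 (k n).2), (fun n => V (k n).1 (k n).2); split.
- by move=> n; have [] := UV (k n).1.
- by move=> n; have [] := UV (k n).1.
- apply/seteqP; split=> [x [i _]|x [n _ UVx]].
    have [_ _ ->] := UV i => -[j _ UVx].
    by exists (pickle (i, j)) => //; rewrite /k pickleK.
  by exists (k n).1 => //; have [_ _ ->] := UV (k n).1; exists (k n).2.
Qed.

Lemma sigma2_bigcupT (T : countType) (P : set T) (S : T -> set X) :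
  (forall t, P t -> sigma2 (S t)) -> sigma2 (\bigcup_(t in P) S t).
Proof.
move=> sS; rewrite bigcup_countable_cover; apply: sigma2_bigcup => n.
rewrite /countable_cover; case: unpickle => [t|]; last exact: (sigma2_open open0).
by case: ifPn => [/asboolP/sS//|_]; apply: (sigma2_open open0).
Qed.

Lemma sigma2U S T : sigma2 S -> sigma2 T -> sigma2 (S `|` T).
Proof.
move=> sS sT; rewrite -bigcup2E; apply: sigma2_bigcup => -[//|[//|i]].
exact: (sigma2_open open0).
Qed.

Lemma sigma2_openI S U : sigma2 S -> open U -> sigma2 (S `&` U).
Proof.
move=> [A [B [oA oB ->]]] oU; rewrite setI_bigcupl.
apply: sigma2_bigcup => i; rewrite setIC setIDA.
by apply: sigma2_diff => //; apply: openI.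
Qed.

Lemma pi2_bigcap (T : countType) (P : set T) (S : T -> set X) :
  (forall t, P t -> pi2 (S t)) -> pi2 (\bigcap_(t in P) S t).
Proof. by move=> pS; rewrite /pi2 setC_bigcap; apply: sigma2_bigcupT. Qed.

Lemma pi2I S T : pi2 S -> pi2 T -> pi2 (S `&` T).
Proof. by rewrite /pi2 setCI; exact: sigma2U. Qed.

Lemma pi2_open U : open U -> pi2 U.
Proof. exact: sigma2_closed. Qed.

Lemma pi2_closed U : open U -> pi2 (~` U).
Proof. by move=> oU; rewrite /pi2 setCK; apply: sigma2_open. Qed.

End sigma2_theory.

Lemma sigma2_preimage (X Y : topologicalType) (f : X -> Y) S :
  continuous f -> sigma2 S -> sigma2 (f @^-1` S).
Proof.
move=> /continuousP cf [U [V [oU oV ->]]].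
exists (fun i => f @^-1` U i), (fun i => f @^-1` V i); split=> [i|i|].
- exact: cf.
- exact: cf.
- by rewrite preimage_bigcup.
Qed.

Lemma sigma2_trace (X Y : topologicalType) (f : X -> Y) S :
  inducing f -> sigma2 S -> exists2 T, sigma2 T & S = f @^-1` T.
Proof.
move=> If [U [V [oU oV ->]]].
have /choice[U' UU'] : forall i, exists W, open W /\ U i = f @^-1` W.
  by move=> i; have /If[W] := oU i; exists W.
have /choice[V' VV'] : forall i, exists W, open W /\ V i = f @^-1` W.
  by move=> i; have /If[W] := oV i; exists W.
exists (\bigcup_i (U' i `\` V' i)).
  exists U', V'; split=> [i|i|//]; [exact: (UU' i).1|exact: (VV' i).1].
rewrite preimage_bigcup; apply: eq_bigcupr => i _.
by rewrite (UU' i).2 (VV' i).2.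
Qed.

(** For each [k], the points where exactly one of [f x] and [g x] contains [k] form two differences
    of open sets. As [Pomega] is not Hausdorff, equality need not be closed, so closure under
    intersection with [pi2] sets is what the classes must provide. *)
Lemma pi2_eq_Pomega (X : topologicalType) (f g : X -> Pomega) :
  continuous f -> continuous g -> pi2 [set x | f x = g x].
Proof.
move=> /continuous_PomegaP cf /continuous_PomegaP cg.
have -> : [set x | f x = g x] =
    \bigcap_(k in setT) (~` ([set x | f x k] `\` [set x | g x k]) `&`
                         ~` ([set x | g x k] `\` [set x | f x k])).
  apply/seteqP; split=> x /=.
    by move=> fg k _; split=> -[/=]; rewrite fg.
  move=> fg; apply/seteqP; split=> k xk; apply: contrapT => nk.
    by case: (fg k I) => + _; apply.
  by case: (fg k I) => _; apply.
by apply: pi2_bigcap => k _; apply: pi2I; rewrite /pi2 setCK; apply: sigma2_diff.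
Qed.

(** * Ranks of the elements of a well-order *)

Section ranks.
Context {d : Order.disp_t} {W : orderType d}.
Implicit Types a b : W.

Lemma below_subset a b : (a <= b)%O -> below a `<=` below b.
Proof. by move=> ab c /= ca; apply: lt_le_trans ab. Qed.

(** The cases are the mutually exclusive side conditions of the constructors of [Sigma0]. *)
Lemma rank_cases a :
  [\/ below a #= `I_0, below a #= `I_1, below a #= `I_2 | `I_3 #<= below a].
Proof.
have [[n an]|/infiniteP ia] := pselect (finite_set (below a)); last first.
  constructor 4; apply: card_le_trans ia; exact: card_leT.
case: n an => [|[|[|n]]] an; [by constructor 1|by constructor 2|by constructor 3|].
by constructor 4; rewrite (card_le_eqr an) card_le_II.
Qed.

Lemma rank_uniq a m n : below a #= `I_m -> below a #= `I_n -> m = n.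
Proof.
by move=> am; rewrite (card_eql am) => /card_eq_II.
Qed.

Lemma rank_lt3 a n : below a #= `I_n -> `I_3 #<= below a -> (3 <= n)%N.
Proof. by move=> an; rewrite (card_le_eqr an) card_le_II. Qed.

Lemma wf_minimal (P : W -> Prop) : well_founded (fun b c : W => (b < c)%O) ->
  (exists a, P a) -> exists a, P a /\ forall b, P b -> (a <= b)%O.
Proof.
move=> wf [a]; elim: (wf a) => {}a _ IH Pa.
have [[b Pb ba]|nb] := pselect (exists2 b, P b & (b < a)%O); first exact: IH Pb.
exists a; split=> // b Pb; rewrite leNgt; apply/negP => ba.
by apply: nb; exists b.
Qed.

(** Take the three least elements [m0], [m1], [m2] of [W] in turn. Exactly [m0] and [m1] lie below
    [m2], and [m2] lies below [a] because two elements cannot exhaust [below a]. *)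
Lemma exists_rank2 a : well_founded (fun b c : W => (b < c)%O) ->
  `I_3 #<= below a -> exists2 b, (b < a)%O & below b #= `I_2.
Proof.
move=> wf a3.
have out (D : set W) : D #<= `I_2 -> exists2 c, (c < a)%O & ~ D c.
  move=> D2; apply: contrapT => nc.
  suff : `I_3 #<= `I_2 by rewrite card_le_II.
  apply: card_le_trans D2; apply: card_le_trans a3 _.
  apply: subset_card_le => c ca; apply: contrapT => Dc; apply: nc.
  by exists c.
have [m0 [_ m0P]] : exists m0, True /\ forall b, True -> (m0 <= b)%O.
  by apply: wf_minimal => //; exists a.
have [m1 [m10 m1P]] : exists m1, m1 <> m0 /\ forall b, b <> m0 -> (m1 <= b)%O.
  apply: (wf_minimal (P := fun b => b <> m0)) => //.
  have [|c _ cm0] := out [set m0]; last by exists c.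
  by rewrite (card_le_eql card_set1) card_le_II.
have m01 : m0 != m1 by apply/eqP => /esym.
have e2 : [set m0; m1] #= `I_2.
  have -> : [set m0; m1] = (fun n => if n is 0 then m0 else m1) @` `I_2.
    apply/seteqP; split=> [_ [->|->]|_ [[|n] _ <-]]; [|by exists 1|by left|by right].
    by exists 0.
  apply: inj_card_eq => i j /set_mem i2 /set_mem j2.
  case: i i2 => [|[|//]]; case: j j2 => [|[|//]] //= _ _ e;
    by rewrite e eqxx in m01.
have [m2 [m20 m2P]] : exists m2, ~ [set m0; m1] m2 /\
    forall b, ~ [set m0; m1] b -> (m2 <= b)%O.
  apply: (wf_minimal (P := fun b => ~ [set m0; m1] b)) => //.
  have [|c _ cm0] := out [set m0; m1]; last by exists c.
  by rewrite (card_le_eql e2).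
exists m2.
  have [|c ca cm] := out [set m0; m1]; first by rewrite (card_le_eql e2).
  exact: le_lt_trans (m2P c cm) ca.
suff -> : below m2 = [set m0; m1] by [].
have m02 : m2 <> m0 by move=> e; apply: m20; left.
have m12 : m2 <> m1 by move=> e; apply: m20; right.
apply/seteqP; split=> [c /= cm2|c [->|->] /=].
- by apply: contrapT => /m2P; rewrite leNgt cm2.
- by rewrite /below /= lt_neqAle m0P// andbT; apply/eqP => /esym.
- by rewrite /below /= lt_neqAle m1P// andbT; apply/eqP => /esym.
Qed.

End ranks.

(** * Inversion and closure properties of the classes [Sigma0] *)

Section Sigma0_theory.
Context {d : Order.disp_t} {W : orderType d} {X : topologicalType}.
Implicit Types (a b c : W) (S T U : set X).

Lemma Sigma0_rank0 a S : below a #= `I_0 -> Sigma0 a X S <-> S = set0.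
Proof.
move=> a0; split=> [|->]; last exact: Sigma0_0.
case=> [//|U|U V|b A]; [move=> /(rank_uniq a0)//..|].
by move=> /(rank_lt3 a0).
Qed.

Lemma Sigma0_rank1 a S : below a #= `I_1 -> Sigma0 a X S <-> open S.
Proof.
move=> a1; split=> [|]; last exact: Sigma0_1.
case=> [|U //|U V|b A]; [move=> /(rank_uniq a1)//..|].
by move=> /(rank_lt3 a1).
Qed.

Lemma Sigma0_rank2 a S : below a #= `I_2 -> Sigma0 a X S <-> sigma2 S.
Proof.
move=> a2; split=> [|[U [V [oU oV ->]]]]; last exact: Sigma0_2.
case=> [|U|U V _ oU oV|b A]; [move=> /(rank_uniq a2)//..| |].
  by exists U, V.
by move=> /(rank_lt3 a2).
Qed.

Lemma Sigma0_rank3 a S : `I_3 #<= below a -> Sigma0 a X S <->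
  exists (b : nat -> W) (A : nat -> set X),
    [/\ forall i, (b i < a)%O, forall i, Sigma0 (b i) X (~` A i) &
        S = \bigcup_i A i].
Proof.
move=> a3; split=> [|[b [A [ba bA ->]]]]; last exact: Sigma0_gt2 bA.
case=> [/rank_lt3/(_ a3)//|U /rank_lt3/(_ a3)//|U V /rank_lt3/(_ a3)//|b A].
by exists b, A.
Qed.

Hypothesis wf : well_founded (fun b c : W => (b < c)%O).

(** From level 3 on, a difference of open sets is an admissible term of the union, because its
    complement is again [sigma2] and some element below [a] has rank 2. *)
Lemma Sigma0_sigma2 a S : `I_2 #<= below a -> sigma2 S -> Sigma0 a X S.
Proof.
move=> a2; have [a0|a1|{}a2|a3] := rank_cases a.
- by move: a2; rewrite (card_le_eqr a0) card_le_II.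
- by move: a2; rewrite (card_le_eqr a1) card_le_II.
- exact/(Sigma0_rank2 S a2).2.
move=> [U [V [oU oV ->]]].
have [b ba b2] := exists_rank2 wf a3.
apply/(Sigma0_rank3 _ a3); exists (fun=> b), (fun i => U i `\` V i).
split=> // i; apply/(Sigma0_rank2 _ b2).
rewrite setDE setCI setCK; apply: sigma2U; first exact: sigma2_closed.
exact: sigma2_open.
Qed.

(* In arbitrary spaces Sigma^0_0 and Sigma^0_1 are not closed under union with
   closed sets, so levels below 2 are lifted to 2 first. *)
Lemma Sigma0_max2 a b S : below b #= `I_2 -> Sigma0 a X S ->
  Sigma0 (Order.max a b) X S.
Proof.
move=> b2 aS; have [ab|ba//] := ltP a b.
apply/(Sigma0_rank2 _ b2).
case: aS => {S} [_|U _ oU|U V _ oU oV|e A a3 _ _].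
- exact: (sigma2_open open0).
- exact: sigma2_open.
- by exists U, V.
suff : `I_3 #<= `I_2 by rewrite card_le_II.
rewrite -(card_le_eqr b2); apply: card_le_trans a3 _.
exact: subset_card_le (below_subset (ltW ab)).
Qed.

Lemma sigma2_Sigma0_max2 a b S : below b #= `I_2 -> sigma2 S ->
  Sigma0 (Order.max a b) X S.
Proof.
move=> b2; apply: Sigma0_sigma2; rewrite -(card_le_eql b2).
by apply: subset_card_le; apply: below_subset; rewrite le_max lexx orbT.
Qed.

Lemma Sigma0_set0 a : Sigma0 a X set0.
Proof.
have [a0|a1|a2|a3] := rank_cases a.
- exact/Sigma0_rank0.
- by apply/Sigma0_rank1 => //; exact: open0.
- by apply/Sigma0_rank2 => //; apply: (sigma2_open open0).
- apply: Sigma0_sigma2 (sigma2_open open0).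
  by apply: card_le_trans a3; rewrite card_le_II.
Qed.

Lemma Sigma0_bigcup a (S : nat -> set X) :
  (forall i, Sigma0 a X (S i)) -> Sigma0 a X (\bigcup_i S i).
Proof.
move=> aS; have [a0|a1|a2|a3] := rank_cases a.
- apply/Sigma0_rank0 => //; rewrite bigcup0// => i _.
  exact/(Sigma0_rank0 (S i) a0).1.
- apply/Sigma0_rank1 => //; apply: bigcup_open => i _.
  exact/(Sigma0_rank1 _ a1).
- apply/Sigma0_rank2 => //; apply: sigma2_bigcup => i.
  exact/(Sigma0_rank2 _ a2).
have {}aS i := (Sigma0_rank3 (S i) a3).1 (aS i).
have [b {}aS] := choice aS; have [A {}aS] := choice aS.
pose k n : nat * nat := odflt (0, 0) (unpickle n).
apply/(Sigma0_rank3 _ a3).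
exists (fun n => b (k n).1 (k n).2), (fun n => A (k n).1 (k n).2); split.
- by move=> n; have [] := aS (k n).1.
- by move=> n; have [] := aS (k n).1.
- apply/seteqP; split=> [x [i _]|x [n _ Ax]].
    have [_ _ ->] := aS i => -[j _ Ax].
    by exists (pickle (i, j)) => //; rewrite /k pickleK.
  by exists (k n).1 => //; have [_ _ ->] := aS (k n).1; exists (k n).2.
Qed.

Lemma Sigma0_bigcupT a (T : countType) (P : set T) (S : T -> set X) :
  (forall t, P t -> Sigma0 a X (S t)) -> Sigma0 a X (\bigcup_(t in P) S t).
Proof.
move=> sS; rewrite bigcup_countable_cover; apply: Sigma0_bigcup => n.
rewrite /countable_cover; case: unpickle => [t|]; last exact: Sigma0_set0.
by case: ifPn => [/asboolP/sS//|_]; apply: Sigma0_set0.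
Qed.

Lemma Sigma0U a S T : Sigma0 a X S -> Sigma0 a X T -> Sigma0 a X (S `|` T).
Proof.
move=> sS sT; rewrite -bigcup2E; apply: Sigma0_bigcup => -[//|[//|i]].
exact: Sigma0_set0.
Qed.

(** The complement of [A i]&[Q] is the union of a set at level [b i] and a [sigma2] set. Both lie at
    the maximum of [b i] and the element of rank 2, which is still below [a]. *)
Lemma Sigma0_pi2I a S Q : `I_3 #<= below a -> Sigma0 a X S -> pi2 Q ->
  Sigma0 a X (S `&` Q).
Proof.
move=> a3 /(Sigma0_rank3 _ a3)[b [A [ba bA ->]]] pQ.
have [e ea e2] := exists_rank2 wf a3.
apply/(Sigma0_rank3 _ a3).
exists (fun i => Order.max (b i) e), (fun i => A i `&` Q); split=> [i|i|].
- by rewrite gt_max ba ea.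
- rewrite setCI; apply: Sigma0U; first exact: Sigma0_max2.
  exact: sigma2_Sigma0_max2.
- by rewrite setI_bigcupl.
Qed.

(** Unlike [pi2] sets, open sets are absorbed at every level. The forcing argument relies on this
    when it cuts sets down by [compat]. *)
Lemma Sigma0_openI a S U : Sigma0 a X S -> open U -> Sigma0 a X (S `&` U).
Proof.
move=> aS oU; have [a0|a1|a2|a3] := rank_cases a.
- move/(Sigma0_rank0 _ a0): aS => ->; rewrite set0I; exact: Sigma0_set0.
- by apply/Sigma0_rank1 => //; apply: openI => //; apply/(Sigma0_rank1 _ a1).
- by apply/Sigma0_rank2 => //; apply: sigma2_openI => //; apply/(Sigma0_rank2 _ a2).
- by apply: Sigma0_pi2I => //; apply: pi2_open.
Qed.

End Sigma0_theory.

Lemma Sigma0_preimage d (W : orderType d) (a : W) (X Y : topologicalType)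
    (f : Y -> X) S :
  continuous f -> Sigma0 a X S -> Sigma0 a Y (f @^-1` S).
Proof.
move=> + aS; elim: aS f => {a X S}
  [a X a0|a X U a1 oU|a X U V a2 oU oV|a X b A a3 ba _ IH] f cf.
- by rewrite preimage_set0; apply: Sigma0_0.
- by apply: Sigma0_1 => //; move/continuousP: cf; apply.
- move/continuousP: cf => cf.
  rewrite preimage_bigcup; apply: (Sigma0_2 (U := fun i => f @^-1` U i)
    (V := fun i => f @^-1` V i)) => // i; exact: cf.
- rewrite preimage_bigcup; apply: (Sigma0_gt2 (b := b)) => // i.
  exact: IH cf.
Qed.

(** For open sets this is the definition of [inducing]; complements and countable unions commute
    with preimages. *)
Lemma Sigma0_trace d (W : orderType d) (a : W) (X Y : topologicalType)
    (f : Y -> X) S :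
  inducing f -> Sigma0 a Y S -> exists2 T, Sigma0 a X T & S = f @^-1` T.
Proof.
move=> + aS; elim: aS f => {a Y S}
  [a Y a0|a Y U a1 oU|a Y U V a2 oU oV|a Y b A a3 ba _ IH] f If.
- by exists set0; [exact: Sigma0_0|rewrite preimage_set0].
- by have /If[V oV ->] := oU; exists V => //; apply: Sigma0_1.
- have [|T sT ->] := sigma2_trace If (S := \bigcup_i (U i `\` V i)).
    by exists U, V.
  by exists T => //; apply/Sigma0_rank2.
have /choice[B AB] : forall i, exists B, Sigma0 (b i) X (~` B) /\ A i = f @^-1` B.
  move=> i; have [T bT AT] := IH i f If; exists (~` T); rewrite setCK; split=> //.
  by rewrite -[A i]setCK AT.
exists (\bigcup_i B i).
  by apply: (Sigma0_gt2 (b := b)) => // i; have [] := AB i.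
by rewrite preimage_bigcup; apply: eq_bigcupr => i _; have [] := AB i.
Qed.

(** * Transfer of Borel classes along rho *)

(** An entry 0 enumerates nothing, so that the empty set has a name too. *)
Definition rho (p : baire_space) : Pomega := [set k | exists i, p i = k.+1].

Lemma continuous_rho : continuous rho.
Proof.
apply/continuous_PomegaP => k.
have -> : [set p | rho p k] = \bigcup_i [set p : baire_space | p i = k.+1].
  by apply/seteqP; split=> [p [i pi]|p [i _ pi]]; exists i.
by apply: bigcup_open => i _; exact: open_baire_coord.
Qed.

(** This is the image of [cylinder s] under [rho]: [s] begins some name of [x] iff it lists only
    elements of [x]. *)
Definition compat (s : seq nat) : set Pomega :=
  [set x | forall k, k.+1 \in s -> x k].

Lemma open_compat s : open (compat s).
Proof.
apply/Pomega_openP => x sx; exists [set k | k.+1 \in s]; split.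
- apply: (@sub_finite_set _ _ (predn @` [set` s])).
    by move=> k ks; exists k.+1.
  exact/finite_image/finite_seq.
- by move=> k /sx.
- by move=> y sy k /sy.
Qed.

Lemma compat_rcons s x n : compat s x -> (forall k, n = k.+1 -> x k) ->
  compat (rcons s n) x.
Proof. by move=> sx xn k; rewrite mem_rcons inE => /orP[/eqP/esym/xn//|/sx]. Qed.

Lemma compat_mkseq p n : compat (mkseq p n) (rho p).
Proof. by move=> k /mapP[i _ ki]; exists i. Qed.

(** * Prefixes and generic points in the fibres of [rho] *)

Lemma prefix_mkseq (p : baire_space) m n : (m <= n)%N ->
  prefix (mkseq p m) (mkseq p n).
Proof.
move=> mn; rewrite prefixE size_mkseq /mkseq -map_take take_iota.
by rewrite (minn_idPl mn).
Qed.

Lemma nth_prefix (s t : seq nat) i : prefix s t -> (i < size s)%N ->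
  nth 0 s i = nth 0 t i.
Proof. by move=> /prefixP[u ->] si; rewrite nth_cat si. Qed.

(** Since the compatible sequences are the prefixes of the names of [x], this is density, in the
    fibre of [rho] over [x], of the points having a prefix in [D]. *)
Definition dense_at (x : Pomega) (D : set (seq nat)) : Prop :=
  forall s, compat s x -> exists t, [/\ prefix s t, compat t x & D t].

Definition meets (p : baire_space) (D : set (seq nat)) : Prop :=
  exists n, D (mkseq p n).

(** A Baire category argument inside the fibre. Stage [n] extends the current sequence into [D n]
    and then lists [n] if it belongs to [x], so that the limit is a name of exactly [x]. *)
Lemma exists_generic x (D : nat -> set (seq nat)) s :
  (forall k, dense_at x (D k)) -> compat s x ->
  exists p, [/\ rho p = x, cylinder s p & forall k, meets p (D k)].
Proof.
move=> dD sx.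
have step (nt : nat * seq nat) : exists v, compat nt.2 x ->
    [/\ prefix nt.2 v, compat v x, (size nt.2 < size v)%N,
        x nt.1 -> nt.1.+1 \in v & exists2 u, prefix u v & D nt.1 u].
  case: nt => n t /=.
  have [tx|?] := pselect (compat t x); last by exists t.
  have [u [tu ux Du]] := dD n t tx.
  (* The padding entry 0 makes the sequence strictly longer even when [n] is not in [x]. *)
  exists (rcons u (if `[< x n >] then n.+1 else 0)) => _; split.
  - exact: prefix_trans tu (prefix_rcons _ _).
  - by apply: compat_rcons => // k; case: ifPn => // /asboolP xn [<-].
  - by rewrite size_rcons ltnS; apply: size_prefix.
  - by move=> xn; rewrite asboolT// mem_rcons mem_head.
  - by exists u => //; apply: prefix_rcons.
have {step} [f fP] := choice step.
pose S := fix S n := if n is m.+1 then f (m, S m) else s.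
have Sx n : compat (S n) x.
  by elim: n => //= n IH; have [] := fP (n, S n) IH.
have SS m n : (m <= n)%N -> prefix (S m) (S n).
  move=> /subnK <-; elim: (n - m)%N => [|k IH]; first exact: prefix_refl.
  have [st _ _ _ _] := fP ((k + m)%N, S (k + m)%N) (Sx _).
  exact: prefix_trans IH st.
have Ssize n : (n <= size (S n))%N.
  elim: n => // n IH; have [_ _ lt_nS _ _] := fP (n, S n) (Sx n).
  exact: leq_ltn_trans IH lt_nS.
(* Stage [i.+1] has length at least [i.+1], so entry [i] is a true entry and not the default. *)
pose p : baire_space := fun i => nth 0 (S i.+1) i.
have pS n i : (i < size (S n))%N -> p i = nth 0 (S n) i.
  move=> iS; rewrite (nth_prefix (SS _ _ (leq_maxl n i.+1)) iS).
  exact: nth_prefix (SS _ _ (leq_maxr n i.+1)) (Ssize i.+1).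
have pu n u : prefix u (S n) -> mkseq p (size u) = u.
  move=> uS; apply: (@eq_from_nth _ 0); rewrite size_mkseq// => i iu.
  rewrite nth_mkseq// (nth_prefix uS iu); apply: pS.
  exact: leq_trans iu (size_prefix uS).
exists p; split.
- apply/seteqP; split=> k.
    move=> [i pik]; apply: (Sx i.+1); rewrite -pik; apply: mem_nth.
    exact: Ssize.
  move=> xk; have [_ _ _ /(_ xk) kS _] := fP (k, S k) (Sx k).
  exists (index k.+1 (S k.+1)); rewrite (pS k.+1) ?index_mem//.
  exact: nth_index.
- exact: pu (prefix_refl _ : prefix s (S 0)).
- move=> k; have [_ _ _ _ [u uS Du]] := fP (k, S k) (Sx k).
  by exists (size u); rewrite (pu k.+1).
Qed.

(* [F s x] reads "s forces B over x": the points of the fibre of x under rho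
   that meet countably many dense sets are in B iff one of their prefixes
   forces it. *)
Definition forcing (B : set baire_space) (F : seq nat -> set Pomega) : Prop :=
  (forall s t, prefix s t -> F s `<=` F t) /\
  forall x, exists D : nat -> set (seq nat), (forall k, dense_at x (D k)) /\
    forall p, rho p = x -> (forall k, meets p (D k)) ->
      B p <-> exists n, F (mkseq p n) x.

(** * Forcing through the Borel operations *)

Lemma forcing_open U : open U ->
  forcing U (fun s => [set _ | cylinder s `<=` U]).
Proof.
move=> oU; split=> [s t st y /= sU p tp|x].
  apply: sU; have := prefix_mkseq p (size_prefix st).
  by move: st; rewrite /cylinder /= tp !prefixE size_mkseq => /eqP + /eqP <-.
(* Membership in an open set is settled by a prefix of any point, so no genericity is imposed. *)
exists (fun=> setT); split=> [_ s sx|p _ _].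
  by exists s; split=> //; apply: prefix_refl.
split=> [Up|[n]]; last by apply; exact: cylinder_mkseq.
exact/baire_nbhsP/open_nbhs_nbhs.
Qed.

Lemma forcing_bigcup (B : nat -> set baire_space) F :
  (forall i, forcing (B i) (F i)) ->
  forcing (\bigcup_i B i) (fun s => \bigcup_i F i s).
Proof.
move=> BF; split=> [s t st x [i _ Fx]|x].
  by exists i => //; apply: (BF i).1 st _ Fx.
have /choice[D DP] i := (BF i).2 x.
pose k n : nat * nat := odflt (0, 0) (unpickle n).
exists (fun n => D (k n).1 (k n).2); split=> [n|p px pD].
  by have [] := DP (k n).1.
have pDi i j : meets p (D i j).
  by have := pD (pickle (i, j)); rewrite /k pickleK.
split=> [[i _ /((DP i).2 p px (pDi i))[n Fn]]|[n [i _ Fn]]].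
  by exists n, i.
by exists i => //; apply/((DP i).2 p px (pDi i)); exists n.
Qed.

(** A sequence forces the complement when no compatible extension forces [B]. The sequences that
    force one or the other are dense, so one more dense set, [E], makes every generic point
    decide. *)
Lemma forcing_setC B F : forcing B F ->
  forcing (~` B)
    (fun s => ~` \bigcup_(t in [set t | prefix s t]) (F t `&` compat t)).
Proof.
move=> [Fmono BF]; split=> [s t st x + [u /= tu Fu]|x].
  by apply; exists u => //=; apply: prefix_trans tu.
have [D [dD DP]] := BF x.
pose E := [set s | F s x \/
  ~ (\bigcup_(t in [set t | prefix s t]) (F t `&` compat t)) x].
exists (fun k => if k is j.+1 then D j else E); split=> [[|//]|p px pD].
  move=> s sx; have [[t st [Ft tx]]|nF] := pselect
      ((\bigcup_(t in [set t | prefix s t]) (F t `&` compat t)) x).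
    by exists t; split=> //; left.
  by exists s; split=> //; [exact: prefix_refl|right].
have {}DP := DP p px (fun k => pD k.+1).
split=> [nB|[n nF] /DP[m Fm]].
  have [n [Fn|?]] := pD 0; last by exists n.
  by exfalso; apply/nB/DP; exists n.
(* If one prefix forced the complement and another forced [B], the longer of the two would be a
   forbidden extension of the first. *)
apply: nF; exists (mkseq p (maxn n m)); first exact: prefix_mkseq (leq_maxl _ _).
split; last by rewrite -px; apply: compat_mkseq.
by apply: Fmono Fm; exact: prefix_mkseq (leq_maxr _ _).
Qed.

Lemma forcing_setI B C F G : forcing B F -> forcing C G ->
  forcing (B `&` C) (fun s => F s `&` G s).
Proof.
move=> [Fm BF] [Gm CG]; split=> [s t st x [Fx Gx]|x].
  by split; [apply: Fm Fx|apply: Gm Gx].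
have [D [dD DP]] := BF x; have [E [dE EP]] := CG x.
(* The two families of dense sets are interleaved, [D] at odd and [E] at even indices. *)
exists (fun n => if odd n then D n./2 else E n./2); split=> [n|p px pDE].
  by case: ifP.
have {}DP : B p <-> exists n, F (mkseq p n) x.
  by apply: DP => // k; have := pDE k.*2.+1; rewrite /= odd_double /= uphalf_double.
have {}EP : C p <-> exists n, G (mkseq p n) x.
  by apply: EP => // k; have := pDE k.*2; rewrite odd_double doubleK.
split=> [[/DP[m Fp] /EP[n Gp]]|[n [Fp Gp]]].
  exists (maxn m n); split.
    by apply: Fm Fp; exact: prefix_mkseq (leq_maxl _ _).
  by apply: Gm Gp; exact: prefix_mkseq (leq_maxr _ _).
by split; [apply/DP; exists n|apply/EP; exists n].
Qed.

(** The preimage of [A] contains a whole fibre or none of it, so one generic point of the fibre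
    decides whether [x] is in [A]. Genericity is available through any compatible prefix. *)
Lemma forcing_rho A F : forcing (rho @^-1` A) F ->
  A = \bigcup_s (F s `&` compat s).
Proof.
move=> [_ AF]; apply/seteqP; split=> [x Ax|x [s _ [Fx sx]]].
all: have [D [dD DP]] := AF x.
  have [|p [px _ pD]] := @exists_generic x D [::] dD; first by [].
  have [|n Fx] := (DP p px pD).1; first by rewrite /= px.
  by exists (mkseq p n) => //; split=> //; rewrite -px; apply: compat_mkseq.
have [p [px sp pD]] := exists_generic dD sx.
by rewrite -px; apply/(DP p px pD); exists (size s); rewrite sp.
Qed.

(** Well-founded induction on the level: countable unions and complements act on forcing sets as
    they act on the forced sets, up to countable unions over sequences and open conditions, which
    each level absorbs. *)
Lemma Sigma0_forcing d (W : orderType d) (a : W) B :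
  well_founded (fun b c : W => (b < c)%O) -> Sigma0 a baire_space B ->
  exists2 F, forcing B F & forall s, Sigma0 a Pomega (F s).
Proof.
move=> wf; elim: (wf a) B => {}a _ IH B.
have force_open s (U : set baire_space) :
    open ([set _ | cylinder s `<=` U] : set Pomega).
  have [sU|nsU] := pselect (cylinder s `<=` U).
    suff -> : [set _ | cylinder s `<=` U] = [set: Pomega] by exact: openT.
    by apply/seteqP; split.
  suff -> : [set _ | cylinder s `<=` U] = set0 :> set Pomega by exact: open0.
  by apply/seteqP; split.
have [a0|a1|a2|a3] := rank_cases a.
- move=> /(Sigma0_rank0 _ a0)->; exists (fun s => [set _ | cylinder s `<=` set0]).
    exact: forcing_open open0.
  (* No sequence forces the empty set, because [cylinder s] contains [s] continued by zeros. *)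
  move=> s; apply/(Sigma0_rank0 _ a0)/seteqP; split=> // x /= /(_ (nth 0 s)).
  by apply; rewrite /cylinder /=; exact: mkseq_nth 0 s.
- move=> /(Sigma0_rank1 _ a1) oB; exists (fun s => [set _ | cylinder s `<=` B]).
    exact: forcing_open.
  by move=> s; apply/(Sigma0_rank1 _ a1).
- move=> /(Sigma0_rank2 _ a2)[U [V [oU oV ->]]].
  eexists.
    apply: forcing_bigcup => i; rewrite setDE; apply: forcing_setI.
      exact: forcing_open (oU i).
    exact/forcing_setC/forcing_open/oV.
  (* Forcing a difference of open sets is itself a difference of open sets. *)
  move=> s; apply/(Sigma0_rank2 _ a2)/sigma2_bigcup => i; rewrite -setDE.
  apply: sigma2_diff => //; apply: bigcup_open => t _.
  by apply: openI; [|exact: open_compat].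
move=> /(Sigma0_rank3 _ a3)[b [A [ba bA ->]]].
have /choice[F FP] : forall i, exists F, forcing (~` A i) F /\
    forall s, Sigma0 (b i) Pomega (F s).
  by move=> i; have [F AF bF] := IH _ (ba i) _ (bA i); exists F.
eexists.
  by apply: forcing_bigcup => i; rewrite -[A i]setCK; apply/forcing_setC/(FP i).1.
move=> s; apply/(Sigma0_rank3 _ a3); exists b.
(* The complement of the set where [s] forces [A i] is a countable union of sets at level [b i]. *)
eexists; split=> // i; rewrite setCK; apply: Sigma0_bigcupT => // t _.
by apply: Sigma0_openI => //; [exact: (FP i).2|exact: open_compat].
Qed.

Lemma Sigma0_rho d (W : orderType d) (a : W) A :
  well_founded (fun b c : W => (b < c)%O) ->
  Sigma0 a baire_space (rho @^-1` A) -> Sigma0 a Pomega A.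
Proof.
move=> wf /(Sigma0_forcing wf)[F /forcing_rho-> aF].
apply: Sigma0_bigcupT => // s _; apply: Sigma0_openI => //.
exact: open_compat.
Qed.

(** * Projective classes *)

Lemma continuous_pair (X Y Z : topologicalType) (f : X -> Y) (g : X -> Z) :
  continuous f -> continuous g -> continuous (fun x => (f x, g x)).
Proof. by move=> cf cg x; apply: cvg_pair; [exact: cf|exact: cg]. Qed.

Lemma continuous_fst (X Y : topologicalType) : continuous (@fst X Y).
Proof. by move=> x; apply: cvg_fst. Qed.

Lemma continuous_snd (X Y : topologicalType) : continuous (@snd X Y).
Proof. by move=> x; apply: cvg_snd. Qed.

Lemma continuous_compose (X Y Z : topologicalType) (f : X -> Y) (g : Y -> Z) :
  continuous f -> continuous g -> continuous (g \o f).
Proof. by move=> cf cg x; apply: continuous_comp; [exact: cf|exact: cg]. Qed.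

Lemma inducing_continuousP (X Y Z : topologicalType) (f : X -> Y) (g : Z -> X) :
  inducing f -> continuous (f \o g) -> continuous g.
Proof.
by move=> If /continuousP cfg; apply/continuousP => _ /If[V /cfg ? ->].
Qed.

(** This carries [f] under the quantifier over the Baire space in the projective hierarchy. *)
Definition idprod (T X Y : topologicalType) (f : X -> Y) (z : T * X) : T * Y :=
  (z.1, f z.2).

Lemma continuous_idprod (T X Y : topologicalType) (f : X -> Y) :
  continuous f -> continuous (@idprod T X Y f).
Proof.
move=> cf; apply: continuous_pair; first exact: continuous_fst.
exact: continuous_compose (@continuous_snd _ _) cf.
Qed.

(** An open set of the source is a union of boxes whose second side is a preimage of an open set of
    [Y]; the boxes over those open sets make up the required set. *)
Lemma inducing_idprod (T X Y : topologicalType) (f : X -> Y) :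
  inducing f -> inducing (@idprod T X Y f).
Proof.
move=> If U; split=> [oU|[V oV ->]]; last first.
  have /continuousP := continuous_idprod (T := T) (inducing_continuous If).
  exact.
pose C := [set PQ : set T * set Y | [/\ open PQ.1, open PQ.2 &
  idprod f @^-1` (PQ.1 `*` PQ.2) `<=` U]].
exists (\bigcup_(PQ in C) (PQ.1 `*` PQ.2)).
  apply: bigcup_open => -[P Q] [/= oP oQ _].
  rewrite openE => -[t y] [/= Pt Qy]; exists (P, Q) => //; split=> /=.
    exact: open_nbhs_nbhs.
  exact: open_nbhs_nbhs.
apply/seteqP; split=> [[t x] Utx|z [[P Q] [_ _]]]; last exact.
have [[P Q] /= []] : nbhs (t, x) U by apply: open_nbhs_nbhs.
rewrite !nbhsE => -[P' [oP' P't] P'P] [_ [/If[Q' oQ' ->] Q'x] Q'Q] PQU.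
exists (P', Q') => //; split=> //= -[u v] [/= P'u Q'v].
by apply: PQU; split; [exact: P'P|exact: Q'Q].
Qed.

Lemma pr_idprod (X Y : topologicalType) (f : X -> Y) A :
  pr (idprod f @^-1` A) = f @^-1` pr A.
Proof. by apply/seteqP; split=> x [p Ap]; exists p. Qed.

Lemma Sigma1_0E (X : topologicalType) (S : set X) : Sigma1 0 X S <-> sigma2 S.
Proof. exact/Sigma0_rank2/card_eqxx. Qed.

Lemma Sigma1_preimage n (X Y : topologicalType) (f : X -> Y) S :
  continuous f -> Sigma1 n Y S -> Sigma1 n X (f @^-1` S).
Proof.
elim: n X Y f S => [|n IH] X Y f S cf; first exact: Sigma0_preimage.
move=> [A sA <-]; exists (idprod f @^-1` A); last exact: pr_idprod.
exact: IH (continuous_idprod cf) sA.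
Qed.

Lemma Sigma1_trace n (X Y : topologicalType) (f : X -> Y) S :
  inducing f -> Sigma1 n X S -> exists2 T, Sigma1 n Y T & S = f @^-1` T.
Proof.
elim: n X Y f S => [|n IH] X Y f S If; first exact: Sigma0_trace.
move=> [A /(IH _ _ _ _ (inducing_idprod If))[B sB AB] <-].
exists (pr (~` B)); first by exists (~` B) => //; rewrite /dual /= setCK.
by rewrite -pr_idprod -[A]setCK AB.
Qed.

Definition shift (p : baire_space) : baire_space := fun i => p i.+1.

Lemma continuous_shift : continuous shift.
Proof. by apply/continuous_baireP => n m; exact: open_baire_coord. Qed.

Lemma sigma2_snd (T X : topologicalType) (S : set X) :
  sigma2 S -> sigma2 [set z : T * X | S z.2].
Proof. exact: sigma2_preimage (@continuous_snd _ _). Qed.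

(* The first entry of the witness codes which of the sets of the union it is
   a witness for. *)
Lemma Sigma1_1_sigma2U (X : topologicalType) (S T : set X) :
  Sigma1 1 X S -> sigma2 T -> Sigma1 1 X (S `|` T).
Proof.
move=> [A /Sigma1_0E pA <-] [U [V [oU oV ->]]].
pose H m : set (baire_space * X) := [set z | z.1 0 = m].
have oH m : open (H m).
  have /continuousP/(_ [set p | p 0 = m]) := @continuous_fst baire_space X.
  by apply; exact: open_baire_coord.
(* Each factor is an implication with an open premise [H], written as the complement of an
   intersection, so that its complement is visibly [sigma2]. *)
pose B := ~` (H 0 `&` [set z | (~` A) (shift z.1, z.2)]) `&`
  \bigcap_(i in setT) ~` (H i.+1 `&` [set z | (~` (U i `\` V i)) z.2]).
exists B.
  apply/Sigma1_0E; apply: pi2I => [|]; rewrite /pi2.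
    rewrite setCK setIC; apply: sigma2_openI => //.
    apply: (sigma2_preimage (f := fun z : baire_space * X => (shift z.1, z.2))) pA.
    apply: continuous_pair; last exact: continuous_snd.
    exact: continuous_compose (@continuous_fst _ _) continuous_shift.
  apply: pi2_bigcap => i _; rewrite /pi2 setCK setIC; apply: sigma2_openI => //.
  apply: sigma2_snd; rewrite setDE setCI setCK.
  by apply: sigma2U; [exact: sigma2_closed|exact: sigma2_open].
apply/seteqP; split=> x.
  move=> [p [/= B0 Bi]]; case p0: (p 0) => [|i].
    by left; exists (shift p); apply: contrapT => nA; apply: B0.
  right; exists i => //; apply: contrapT => nUV; exact: (Bi i I).
move=> [[p Ap]|[i _ UVx]].
  exists (fun i => if i is j.+1 then p j else 0); split=> [[_ /=]|i _ []//].
  exact.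
by exists (fun=> i.+1); split=> [[]//|j _ [[<-] /=]]; apply.
Qed.

(** The two closure properties are proved together because the complement in each step of the
    hierarchy exchanges them. *)
Lemma Sigma1_pi2I_sigma2U n (X : topologicalType) (S : set X) :
  Sigma1 n.+1 X S ->
  (forall Q, pi2 Q -> Sigma1 n.+1 X (S `&` Q)) /\
  (forall T, sigma2 T -> Sigma1 n.+1 X (S `|` T)).
Proof.
elim: n X S => [|n IH] X S sS; split=> [Q pQ|T sT].
- have [A /Sigma1_0E pA <-] := sS.
  exists (A `&` [set z | Q z.2]).
    by apply/Sigma1_0E; apply: pi2I => //; apply: sigma2_snd pQ.
  by apply/seteqP; split=> [x [p []]|x [[p Ap] Qx]]; [split=> //; exists p|exists p].
- exact: Sigma1_1_sigma2U.
- have [A sA <-] := sS; exists (A `&` [set z | Q z.2]).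
    by rewrite /dual /= setCI; apply: (IH _ _ sA).2; apply: sigma2_snd pQ.
  by apply/seteqP; split=> [x [p []]|x [[p Ap] Qx]]; [split=> //; exists p|exists p].
- have [A sA <-] := sS; exists (A `|` [set z | T z.2]).
    rewrite /dual /= setCU; apply: (IH _ _ sA).1; rewrite /pi2 setCK.
    exact: sigma2_snd.
  apply/seteqP; split=> [x [p []]|x [[p Ap]|Tx]]; [by left; exists p|by right| |].
    by exists p; left.
  by exists point; right.
Qed.

(** Two successive witnesses are merged into one, with the outer on its even and the inner on its
    odd entries. *)
Lemma Sigma1_pr n (X : topologicalType) (S : set (baire_space * X)) :
  Sigma1 n.+1 _ S -> Sigma1 n.+1 X (pr S).
Proof.
move=> [A sA <-].
pose ev (p : baire_space) : baire_space := fun i => p i.*2.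
pose od (p : baire_space) : baire_space := fun i => p i.*2.+1.
pose f (z : baire_space * X) := (od z.1, (ev z.1, z.2)).
exists (f @^-1` A).
  apply: (@Sigma1_preimage _ _ _ f) sA; apply: continuous_pair.
    apply: continuous_compose (@continuous_fst _ _) _.
    by apply/continuous_baireP => k m; exact: open_baire_coord.
  apply: continuous_pair; last exact: continuous_snd.
  apply: continuous_compose (@continuous_fst _ _) _.
  by apply/continuous_baireP => k m; exact: open_baire_coord.
apply/seteqP; split=> [x [p Ap]|x [p [q Aqp]]]; first by exists (ev p), (od p).
exists (fun i => if odd i then q i./2 else p i./2).
rewrite /f /=; suff [-> ->] : od (fun i => if odd i then q i./2 else p i./2) = q /\
    ev (fun i => if odd i then q i./2 else p i./2) = p by [].
split; apply/funext => i; rewrite /od /ev /= odd_double ?doubleK//=.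
by rewrite uphalf_double.
Qed.

(* [regular_trace]: a set in the class of a subspace is the trace of a set in
   the class of the whole space. *)
Record regular_class (G : pointclass) : Prop := RegularClass {
  regular_preimage : forall (X Y : topologicalType) (f : X -> Y) S,
    continuous f -> G Y S -> G X (f @^-1` S);
  regular_trace : forall (X Y : topologicalType) (f : X -> Y) S,
    inducing f -> G X S -> exists2 T, G Y T & S = f @^-1` T;
  regular_rho : forall A, G baire_space (rho @^-1` A) -> G Pomega A }.

(** This is kept apart from [regular_class] because it does not pass to the dual class. *)
Definition pi2I_closed (G : pointclass) : Prop :=
  forall (X : topologicalType) (S Q : set X), G X S -> pi2 Q -> G X (S `&` Q).

Lemma regular_dual G : regular_class G -> regular_class (dual G).
Proof.
move=> [Gpre Gtr Grho]; split=> [X Y f S cf|X Y f S If GS|A].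
- exact: Gpre.
- have [T GT ST] := Gtr _ _ _ _ If GS.
  exists (~` T); first by rewrite /dual /= setCK.
  by rewrite -[S]setCK ST.
- exact: Grho.
Qed.

Lemma rho_surj x : exists p, rho p = x.
Proof.
have [||p []] := @exists_generic x (fun=> setT) [::]; [|by []|by exists p].
by move=> _ s sx; exists s; split=> //; exact: prefix_refl.
Qed.

Lemma regular_Sigma0 d (W : orderType d) (a : W) :
  well_founded (fun b c : W => (b < c)%O) -> regular_class (Sigma0 a).
Proof.
move=> wf; split=> [X Y f S|X Y f S|A]; [exact: Sigma0_preimage|exact: Sigma0_trace|].
exact: Sigma0_rho.
Qed.

Lemma regular_Sigma1 n : regular_class (Sigma1 n.+1).
Proof.
split=> [X Y f S|X Y f S|A sA]; [exact: Sigma1_preimage|exact: Sigma1_trace|].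
have -> : A = pr ([set z | A (rho z.1)] `&` [set z | rho z.1 = z.2]).
  apply/seteqP; split=> [x Ax|x [p [/= + <-]]//].
  by have [p px] := rho_surj x; exists p; split=> //=; rewrite px.
apply: Sigma1_pr; apply: (Sigma1_pi2I_sigma2U _).1.
  exact: Sigma1_preimage (@continuous_fst _ _) sA.
apply: pi2_eq_Pomega; last exact: continuous_snd.
exact: continuous_compose (@continuous_fst _ _) continuous_rho.
Qed.

(** * Representations of countably based spaces *)

Lemma CB0_inducing (X Y : topologicalType) (f : X -> Y) :
  inducing f -> injective f -> CB0 Y -> CB0 X.
Proof.
move=> If injf [[B cB [Bo Bx]] T0]; split.
  exists (preimage f @` B); first exact: card_le_trans (card_image_le _ _) cB.
  split=> [_ [U BU <-]|x U]; first by apply/If; exists U => //; exact: Bo.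
  rewrite nbhsE => -[_ [/If[V oV ->] Vx] VU].
  have [C [BC Cx] CV] := Bx (f x) V (open_nbhs_nbhs (conj oV Vx)).
  by exists (f @^-1` C) => [|y /CV/VU//]; split=> //; exists C.
have cf := inducing_continuous If.
move=> x y xy; have [|A] := T0 (f x) (f y); first by apply: contra_neq xy => /injf.
rewrite !in_setE => -[[Ax Ay]|[Ay Ax]]; exists (f @^-1` A); rewrite !in_setE.
  by left; split=> //; exact: cf.
by right; split=> //; exact: cf.
Qed.

Lemma clopen_based_inducing (X Y : topologicalType) (f : X -> Y) :
  inducing f -> clopen_based Y -> clopen_based X.
Proof.
move=> If [_ Bx]; split=> [U []//|x U].
rewrite nbhsE => -[_ [/If[V oV ->] Vx] VU].
have [C [[oC cC] Cx] CV] := Bx (f x) V (open_nbhs_nbhs (conj oV Vx)).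
exists (f @^-1` C) => [|y /CV/VU//]; split=> //; split.
  by apply/If; exists C.
by apply: preimage_closed => // z _; exact: inducing_continuous.
Qed.

Lemma CB0_Pomega : CB0 Pomega.
Proof.
split=> [|x y /eqP xy].
  exists (range (fun s : seq nat => Pomega_up [set` s])).
    exact: card_le_trans (card_image_le _ _) (countableP _).
  split=> [_ [s _ <-]|x U].
    by apply/Pomega_openP => A sA; exists [set` s]; split=> //; exact: finite_seq.
  rewrite nbhsE => -[V [/Pomega_openP VP /VP[F [/finite_seqP[s ->] sx sV]] VU]].
  exists (Pomega_up [set` s]); last exact: subset_trans VU.
  by split=> //; exists s.
have [k xyk] : exists k, ~ (x k <-> y k).
  by apply: contrapT => nk; apply/xy/seteqP; split=> k;
    apply: contrapT => h; apply: nk; exists k; tauto.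
exists [set z : Pomega | z k]; rewrite !in_setE.
have nb z : z k -> nbhs (z : Pomega) [set z | z k].
  by move=> zk; apply: open_nbhs_nbhs; split=> //; exact: open_Pomega_mem.
have [xk|nxk] := pselect (x k); [left|right].
  by split; [exact: nb|move=> /= yk; apply: xyk].
by split=> //; apply: nb; apply: contrapT => nyk; apply: xyk.
Qed.

(** A point is sent to the set of codes of the basic open sets containing it; the separation axiom
    makes this injective. *)
Lemma CB0P (X : topologicalType) :
  CB0 X <-> exists2 e : X -> Pomega, inducing e & injective e.
Proof.
split=> [[[B cB [Bo Bx]] T0]|[e Ie inje]]; last exact: CB0_inducing CB0_Pomega.
have /countable_injP[f injf] := cB.
have {}injf U V : B U -> B V -> f U = f V -> U = V.
  by move=> BU BV; apply: injf; rewrite in_setE.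
pose e (x : X) : Pomega := [set k | exists U, [/\ B U, f U = k & U x]].
have eB U x : B U -> e x (f U) <-> U x.
  by move=> BU; split=> [[V [BV /injf <-]]//|Ux]; exists U.
exists e.
  move=> U; split=> [oU|[V oV ->]]; last first.
    suff /continuousP : continuous e by apply.
    apply/continuous_PomegaP => k.
    suff -> : [set x | e x k] = \bigcup_(U in [set U | B U /\ f U = k]) U.
      by apply: bigcup_open => W [/Bo].
    by apply/seteqP; split=> [x [W [? ? ?]]|x [W [? ?] ?]]; exists W.
  exists (\bigcup_(C in [set C | B C /\ C `<=` U]) [set A : Pomega | A (f C)]).
    by apply: bigcup_open => C _; exact: open_Pomega_mem.
  apply/seteqP; split=> x; last by move=> [C [BC CU] /(eB _ _ BC)/CU].
  move=> Ux; have [C [BC Cx] CU] := Bx x U (open_nbhs_nbhs (conj oU Ux)).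
  by exists C => //; apply/eB.
have sep x y A : e x = e y -> nbhs x A -> A y.
  move=> exy /Bx[C [BC Cx] CA]; apply: CA; apply/(eB _ _ BC).
  by rewrite -exy; apply/eB.
move=> x y exy; apply: contrapT => /eqP/T0[A]; rewrite !in_setE => -[[xA]|[yA]]; apply.
  exact: sep exy xA.
exact: sep (esym exy) yA.
Qed.

Lemma CB0_inP (G : pointclass) (X : topologicalType) :
  CB0_in G X <-> exists e : X -> Pomega,
    [/\ inducing e, injective e & G Pomega (range e)].
Proof.
split=> [[A GA [f [g [cf cg fg gf]]]]|[e [Ie inje Ge]]].
  exists (set_val \o f); split.
  - move=> U; split=> [oU|[V oV ->]].
      have /continuousP/(_ _ oU) [V oV VU] := cg.
      by exists V => //; apply/seteqP; split=> x;
        rewrite -[x in U x]fg -[U (g _)]/((g @^-1` U) (f x)) -VU.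
    have /continuousP/(_ (set_val @^-1` V)) := cf; apply.
    by exists V.
  - by move=> x y /val_inj/(can_inj fg).
  - suff -> : range (set_val \o f) = A by [].
    apply/seteqP; split=> [_ [x _ <-]|a Aa]; first exact: set_valP.
    exists (g (exist _ a (mem_set Aa))) => //=.
    by rewrite gf.
exists (range e) => //.
have er x : e x \in range e by rewrite in_setE.
pose f x : range e := exist (fun a => a \in range e) (e x) (er x).
have /choice[g eg] : forall a : range e, exists x, e x = set_val a.
  by move=> a; have [x _ xa] := set_valP a; exists x.
exists f, g; split.
- apply: (inducing_continuousP (@inducing_set_val _ (range e))).
  exact: inducing_continuous Ie.
- apply: (inducing_continuousP Ie).
  suff -> : e \o g = set_val by exact/inducing_continuous/inducing_set_val.
  exact/funext.
- by move=> x; apply: inje; rewrite eg.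
- by move=> a; apply: val_inj; rewrite /= eg.
Qed.

Lemma CB0_baire : CB0 baire_space.
Proof.
split=> [|p q /eqP pq].
  exists (range cylinder).
    exact: card_le_trans (card_image_le _ _) (countableP _).
  split=> [_ [s _ <-]|p U /baire_nbhsP[n nU]]; first exact: open_cylinder.
  exists (cylinder (mkseq p n)) => //.
  by split; [exists (mkseq p n)|exact: cylinder_mkseq].
have [n pqn] : exists n, p n <> q n.
  apply: contrapT => nn; apply/pq/funext => n; apply: contrapT => pqn.
  by apply: nn; exists n.
exists [set r : baire_space | r n = p n]; left; rewrite !in_setE; split.
  by apply: open_nbhs_nbhs; split=> //; exact: open_baire_coord.
by move=> /= qp; apply: pqn.
Qed.

Lemma clopen_based_baire : clopen_based baire_space.
Proof.
split=> [U []//|p U /baire_nbhsP[n nU]].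
exists (cylinder (mkseq p n)) => //; split; last exact: cylinder_mkseq.
split; first exact: open_cylinder.
rewrite -openC; have -> : ~` cylinder (mkseq p n) =
    \bigcup_(i in [set i | i < n]%N) \bigcup_(m in [set m | m <> p i])
      [set q : baire_space | q i = m].
  rewrite cylinder_mkseqE; apply/seteqP; split=> q.
    move=> /= npq; apply: contrapT => nq; apply: npq.
    apply: (@eq_from_nth _ 0); rewrite ?size_mkseq// => i iN.
    rewrite !nth_mkseq//; apply: contrapT => qpi; apply: nq.
    by exists i => //; exists (q i).
  move=> [i /= iN [m /= npi qi]] /(congr1 (nth 0 ^~ i)).
  by rewrite !nth_mkseq// => qpi; apply: npi; rewrite -qi.
by apply: bigcup_open => i _; apply: bigcup_open => m _; exact: open_baire_coord.
Qed.

(** This gives the admissibility of [rho]. Each open set of the [z] with [n] in [h z] is a countable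
    union of clopen sets [C (n, k)], and [z] is named by listing [n] at the indices of those
    containing [z]; clopenness makes each entry locally constant. *)
Lemma rho_lift (Z : topologicalType) (h : Z -> Pomega) :
  CB0 Z -> clopen_based Z -> continuous h ->
  exists2 k : Z -> baire_space, continuous k & forall z, rho (k z) = h z.
Proof.
move=> [[B cB [Bo Bx]] _] [_ clop] /continuous_PomegaP ch.
have /countable_injP[f injf] := cB.
have {}injf U V : B U -> B V -> f U = f V -> U = V.
  by move=> BU BV; apply: injf; rewrite in_setE.
(* For the basic set [U] of code [nk.2], one clopen set between [U] and the open set is fixed if
   there is any. This keeps the family countable. *)
have /choice[C CP] : forall nk : nat * nat, exists C : set Z,
    [/\ clopen C, C `<=` [set z | h z nk.1] & forall U C', B U -> f U = nk.2 ->
      clopen C' -> U `<=` C' -> C' `<=` [set z | h z nk.1] -> U `<=` C].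
  move=> [n k] /=.
  have [[U [C [BU fU cC UC Ch]]]|nC] := pselect (exists U C,
      [/\ B U, f U = k, clopen C, U `<=` C & C `<=` [set z | h z n]]).
    exists C; split=> // V C' BV fV _ _ _.
    by have -> : V = U by apply: injf => //; rewrite fV.
  exists set0; split=> //; first by split; [exact: open0|exact: closed0].
  by move=> U C' BU fU cC' UC' C'h; case: nC; exists U, C'.
pose d i : nat * nat := odflt (0, 0) (unpickle i).
pose k (z : Z) : baire_space :=
  fun i => if `[< C (d i) z >] then (d i).1.+1 else 0.
exists k.
  apply/continuous_baireP => i m; have [[oC cC] _ _] := CP (d i).
  have kE z : k z i = if `[< C (d i) z >] then (d i).1.+1 else 0 by [].
  have -> : [set z | k z i = m] = (C (d i) `&` [set _ | (d i).1.+1 = m]) `|`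
      (~` C (d i) `&` [set _ | 0 = m]).
    apply/seteqP; split=> z; rewrite /= kE; case: asboolP => Cz //=; tauto.
  have cst_open (P : Prop) : open ([set _ | P] : set Z).
    have [p|np] := pselect P.
      suff -> : [set _ | P] = [set: Z] by exact: openT.
      by apply/seteqP; split.
    suff -> : [set _ | P] = set0 :> set Z by exact: open0.
    by apply/seteqP; split.
  by apply: openU; apply: openI => //; rewrite openC.
move=> z; apply/seteqP; split=> n.
  move=> [i]; rewrite /k; case: asboolP => // Cz [<-].
  by have [_ Ch _] := CP (d i); exact: Ch.
move=> zn; have [C' [cC' C'z] C'h] := clop z _ (open_nbhs_nbhs (conj (ch n) zn)).
have [U [BU Uz] UC'] := Bx z C' (open_nbhs_nbhs (conj cC'.1 C'z)).
exists (pickle (n, f U)); rewrite /k /d pickleK /=.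
have [_ _ /(_ U C' BU erefl cC' UC' C'h _ Uz) Cz] := CP (n, f U).
by rewrite asboolT.
Qed.

(** [Pomega] is an injective space: each coordinate of [h] is an open set, which extends, and any
    sequence of open sets defines a continuous map to [Pomega]. *)
Lemma extend_Pomega (X Y : topologicalType) (i : Y -> X) (h : Y -> Pomega) :
  inducing i -> continuous h ->
  exists2 h' : X -> Pomega, continuous h' & forall y, h' (i y) = h y.
Proof.
move=> Ii /continuous_PomegaP ch.
have /choice[O OP] : forall k, exists O, open O /\ [set y | h y k] = i @^-1` O.
  by move=> k; have /Ii[O] := ch k; exists O.
exists (fun x => [set k | O k x]).
  by apply/continuous_PomegaP => k; have [] := OP k.
move=> y; apply/seteqP; split=> k; have [_ /seteqP[hO Oh]] := OP k.
  exact: Oh.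
exact: hO.
Qed.

(** The open sets for the values of [h] extend, but may overlap or miss points outside the image.
    [Q] requires exactly one value for each entry, a [pi2] condition. *)
Lemma extend_baire (X Y : topologicalType) (i : Y -> X) (h : Y -> baire_space) :
  inducing i -> continuous h ->
  exists (Q : set X) (h' : Q -> baire_space), [/\ pi2 Q, forall y, Q (i y),
    continuous h' & forall y (q : Q), set_val q = i y -> h' q = h y].
Proof.
move=> Ii /continuous_baireP ch.
have /choice[O OP] : forall nm : nat * nat, exists O,
    open O /\ [set y | h y nm.1 = nm.2] = i @^-1` O.
  by move=> nm; have /Ii[O] := ch nm.1 nm.2; exists O.
have Oi n m y : O (n, m) (i y) <-> h y n = m.
  by have [_ /seteqP[hO Oh]] := OP (n, m); split; [exact: Oh|exact: hO].
pose Q := \bigcap_(n in [set: nat]) ((\bigcup_m O (n, m)) `&`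
  \bigcap_(mm in [set mm : nat * nat | mm.1 <> mm.2])
    ~` (O (n, mm.1) `&` O (n, mm.2))).
have Quniq (q : Q) n m m' :
    O (n, m) (set_val q) -> O (n, m') (set_val q) -> m = m'.
  move=> Om Om'; apply: contrapT => mm'.
  by have [_ /(_ (m, m') mm')] := set_valP q n I; apply.
have /choice[h' h'P] : forall q : Q, exists p : baire_space,
    forall n, O (n, p n) (set_val q).
  move=> q; have /choice[p pP] : forall n, exists m, O (n, m) (set_val q).
    by move=> n; have [[m _ Om] _] := set_valP q n I; exists m.
  by exists p.
exists Q, h'; split.
- apply: pi2_bigcap => n _; apply: pi2I.
    by apply/pi2_open/bigcup_open => m _; have [] := OP (n, m).
  apply: pi2_bigcap => -[m m'] _; apply/pi2_closed/openI.
    by have [] := OP (n, m).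
  by have [] := OP (n, m').
- move=> y n _; split; first by exists (h y n) => //; apply/Oi.
  by move=> [m m'] /= mm' [/Oi hm /Oi hm']; apply: mm'; rewrite -hm -hm'.
- apply/continuous_baireP => n m.
  have -> : [set q | h' q n = m] = set_val @^-1` O (n, m).
    apply/seteqP; split=> [q <-|q Oq]; first exact: h'P.
    exact: Quniq (h'P q n) Oq.
  by apply/inducing_set_val; exists (O (n, m)) => //; have [] := OP (n, m).
- move=> y q qy; apply/funext => n; apply/esym/Oi; rewrite -qy; exact: h'P.
Qed.

(** * The two inclusions for a regular class *)

Lemma QCB0_CB0_in (G : pointclass) (X : topologicalType) :
  regular_class G -> pi2I_closed G -> QCB0 G X -> CB0 X -> CB0_in G X.
Proof.
move=> [Gpre Gtr Grho] Gpi [D [delta [[surj cdelta lift] GEQ]]] /CB0P[e Ie inje].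
have ce := inducing_continuous Ie.
apply/CB0_inP; exists e; split=> //; apply: Grho.
(* The domain is the preimage of [EQ delta] under the diagonal map. *)
have GD : G baire_space D.
  suff -> : D = (fun p => (p, p)) @^-1` EQ delta.
    by apply: Gpre GEQ; apply: continuous_pair => p; exact: cvg_id.
  apply/seteqP; split=> [p Dp|_ [p [q [[-> _] _]]]]; last exact: set_valP.
  by exists (exist _ p (mem_set Dp)), (exist _ p (mem_set Dp)).
set E := rho @^-1` range e.
have IE := @inducing_set_val _ E.
have /choice[nu nuP] : forall p : E, exists x, e x = rho (set_val p).
  by move=> p; have [x _ xp] := set_valP p; exists x.
have crv : continuous (rho \o (set_val : E -> _)).
  exact: continuous_compose (inducing_continuous IE) continuous_rho.
have cnu : continuous nu.
  apply: (inducing_continuousP Ie).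
  by have -> : e \o nu = rho \o set_val by exact/funext.
have [||g cg nug] := lift E nu _ _ cnu.
- exact: CB0_inducing IE val_inj CB0_baire.
- exact: clopen_based_inducing IE clopen_based_baire.
have [dt cdt dtP] := extend_Pomega (@inducing_set_val _ D)
  (continuous_compose cdelta ce).
have [Q [g' [pQ QE cg' g'P]]] := extend_baire IE
  (continuous_compose cg (inducing_continuous (@inducing_set_val _ D))).
pose S := g' @^-1` D `&` [set q | dt (g' q) = rho (set_val q)].
have cQ := inducing_continuous (@inducing_set_val _ Q).
(* [S] is in the class only relative to the subspace [Q]; a set [T] with trace [S], cut down by the
   [pi2] set [Q], returns to the whole Baire space. *)
have [T GT ST] : exists2 T, G baire_space T & S = set_val @^-1` T.
  apply: Gtr (@inducing_set_val _ Q) _; apply: Gpi; first exact: Gpre GD.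
  apply: pi2_eq_Pomega; first exact: continuous_compose cg' cdt.
  exact: continuous_compose cQ continuous_rho.
suff -> : E = T `&` Q by exact: Gpi.
apply/seteqP; split=> [p Ep|p [Tp Qp]].
  have Qp : Q p := QE (exist _ p (mem_set Ep)).
  split=> //; pose q : Q := exist _ p (mem_set Qp).
  pose p' : E := exist _ p (mem_set Ep).
  have qg : g' q = set_val (g p') by exact: g'P.
  suff : S q by rewrite ST.
  split; rewrite /= qg; first exact: set_valP.
  rewrite dtP /= -[rho _]/(rho (set_val p')) -nuP.
  by rewrite nug.
(* Conversely, [g' q] lies in [D] and names a point of [X] that [e] sends to [rho p]. *)
pose q : Q := exist _ p (mem_set Qp).
have : S q by rewrite ST.
move=> [/= Dg]; pose r : D := exist _ (g' q) (mem_set Dg).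
rewrite -[g' q]/(set_val r) dtP => er.
by exists (delta r).
Qed.

Lemma CB0_in_QCB0 (G : pointclass) (X : topologicalType) :
  regular_class G -> pi2I_closed G -> CB0_in G X -> QCB0 G X /\ CB0 X.
Proof.
move=> [Gpre Gtr Grho] Gpi /CB0_inP[e [Ie inje Ge]].
split; last by apply/CB0P; exists e.
set D := rho @^-1` range e.
have ID := @inducing_set_val _ D.
have /choice[delta dP] : forall p : D, exists x, e x = rho (set_val p).
  by move=> p; have [x _ xp] := set_valP p; exists x.
exists D, delta; split; first split.
- move=> x; have [p px] := rho_surj (e x).
  have Dp : D p by exists x.
  by exists (exist _ p (mem_set Dp)); apply: inje; rewrite dP.
- apply: (inducing_continuousP Ie).
  have -> : e \o delta = rho \o set_val by exact/funext.
  exact: continuous_compose (inducing_continuous ID) continuous_rho.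
- move=> Z nu cZ zZ cnu.
  have cenu := continuous_compose cnu (inducing_continuous Ie).
  have [k ck kP] := rho_lift cZ zZ cenu.
  have kD z : k z \in D by rewrite in_setE; exists (nu z); rewrite // kP.
  exists (fun z => exist (fun p => p \in D) (k z) (kD z) : D).
    exact: (inducing_continuousP ID).
  by apply/funext => z; apply: inje; rewrite /= dP /= kP.
(* Membership in [D] depends only on the value of [rho], so it passes from the first component to
   the second. *)
have -> : EQ delta = fst @^-1` D `&` [set z | rho z.1 = rho z.2].
  apply/seteqP; split=> [_ [p [q [-> pq]]]|[p q] [/= Dp pq]].
    by split; [exact: set_valP|rewrite /= -!dP pq].
  have Dq : D q by rewrite /D /= -pq.
  exists (exist _ p (mem_set Dp)), (exist _ q (mem_set Dq)); split=> //.
  by apply: inje; rewrite !dP.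
apply: Gpi.
  apply: (Gpre); first exact: continuous_fst.
  exact: Gpre continuous_rho Ge.
apply: pi2_eq_Pomega.
  exact: continuous_compose (@continuous_fst _ _) continuous_rho.
exact: continuous_compose (@continuous_snd _ _) continuous_rho.
Qed.

Lemma QCB0_CB0E (G : pointclass) : regular_class G -> pi2I_closed G ->
  forall X : topologicalType, QCB0 G X /\ CB0 X <-> CB0_in G X.
Proof.
move=> rG pG X; split=> [[]|]; first exact: QCB0_CB0_in.
exact: CB0_in_QCB0.
Qed.

Lemma QCB0_Sigma0 d (W : orderType d) (a : W) :
  well_founded (fun b c : W => (b < c)%O) -> `I_3 #<= below a ->
  forall X : topologicalType, QCB0 (Sigma0 a) X /\ CB0 X <-> CB0_in (Sigma0 a) X.
Proof.
move=> wf a3; apply: QCB0_CB0E; first exact: regular_Sigma0.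
by move=> X S Q; exact: Sigma0_pi2I.
Qed.

(** Level 2 suffices here: the complement of an intersection with a [pi2] set is a union with a
    [sigma2] set, which already belongs to level 2. *)
Lemma QCB0_Pi0 d (W : orderType d) (a : W) :
  well_founded (fun b c : W => (b < c)%O) -> `I_2 #<= below a ->
  forall X : topologicalType, QCB0 (Pi0 a) X /\ CB0 X <-> CB0_in (Pi0 a) X.
Proof.
move=> wf a2; apply: QCB0_CB0E; first exact/regular_dual/regular_Sigma0.
move=> X S Q aS pQ; rewrite /Pi0 /dual /= setCI; apply: Sigma0U => //.
exact: Sigma0_sigma2.
Qed.

Theorem theorem6p3 :
  ((forall (d : Order.disp_t) (W : orderType d) (alpha : W),
      well_founded (fun b c : W => (b < c)%O) -> countable [set: W] ->
      infinite_set (below alpha) ->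
      (forall X : topologicalType,
         QCB0 (Sigma0 alpha) X /\ CB0 X <-> CB0_in (Sigma0 alpha) X) /\
      (forall X : topologicalType,
         QCB0 (Pi0 alpha) X /\ CB0 X <-> CB0_in (Pi0 alpha) X)) /\
   (forall n : nat, (1 <= n)%N ->
      (forall X : topologicalType,
         QCB0 (Sigma1 n) X /\ CB0 X <-> CB0_in (Sigma1 n) X) /\
      (forall X : topologicalType,
         QCB0 (Pi1 n) X /\ CB0 X <-> CB0_in (Pi1 n) X))) /\
  (forall m n : nat, (2 <= m)%N -> (3 <= n)%N ->
      (forall X : topologicalType,
         QCB0 (Pi0 m) X /\ CB0 X <-> CB0_in (Pi0 m) X) /\
      (forall X : topologicalType,
         QCB0 (Sigma0 n) X /\ CB0 X <-> CB0_in (Sigma0 n) X)).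
Proof.
have wf_nat : well_founded (fun b c : nat => (b < c)%O).
  by elim/ltn_ind => n IH; constructor => m mn; exact: IH.
split; [split=> [d W alpha wf _ /infiniteP aoo|[//|n] _]|move=> m n m2 n3].
(* An infinite level has at least any finite number of elements below it, so both bounds hold. *)
- have aI k : `I_k #<= below alpha by apply: card_le_trans aoo; exact: card_leT.
  by split; [exact: QCB0_Sigma0|exact: QCB0_Pi0].
- split; apply: QCB0_CB0E.
  + exact: regular_Sigma1.
  + by move=> X S Q /Sigma1_pi2I_sigma2U[+ _]; apply.
  + exact/regular_dual/regular_Sigma1.
  + move=> X S Q /Sigma1_pi2I_sigma2U[_ SU] pQ.
    by rewrite /Pi1 /dual /= setCI; apply: SU.
- have below_nat k j : (k <= j)%N -> `I_k #<= below (j : nat).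
    by move=> kj; apply: subset_card_le => i /leq_trans; apply.
  by split; [apply: QCB0_Pi0|apply: QCB0_Sigma0] => //; exact: below_nat.
Qed.
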